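(* Let $k \ge 3$ be an odd integer and let $n \ge 1$ be an integer. Then $\mu_k(n) = \frac{1}{n}\sum_{j=1}^{n} j^k$ is an integer if and only if $n \not\equiv 2 \pmod{4}$.
   Context: $\mu_k(n)$ denotes the average $\frac{1}{n}(1^k + 2^k + \cdots + n^k)$ of the first $n$ $k$-th powers. *)

(* Defs.v *)
From mathcomp Require Import all_boot all_order all_algebra.
Set Implicit Arguments.
Unset Strict Implicit.
Unset Printing Implicit Defensive.
Import GRing.Theory.
Local Open Scope ring_scope.

(* Exact rational average; the value at n = 0 is the junk value 0. *)
Definition mu (k n : nat) : rat :=
  n%:R^-1 * \sum_(1 <= j < n.+1) j%:R ^+ k.

(* Main.v *)
Require Import Defs.
From mathcomp Require Import all_boot all_order all_algebra.
From mathcomp Require Import zify ring.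
Import GRing.Theory Num.Theory.
Local Open Scope ring_scope.

(** For odd k, a + b divides a^k + b^k, so pairing j with n - j kills every
    term of 0^k + ... + n^k modulo n, except the unpaired middle term (n/2)^k
    when n is even.  With n = 2m this leaves the condition 2m | m^k, which
    for k >= 2 says that m is even. *)

(** Induction on odd exponents in steps of two: adding [a * b] times the previous sum to the next
    one gives a multiple of [a + b]. *)
Lemma dvdn_addXX_odd (k a b : nat) : odd k -> (a + b %| a ^ k + b ^ k)%N.
Proof.
move=> hk; have -> : k = k./2.*2.+1 by rewrite -[LHS]odd_double_half hk.
elim: (k./2) => [|i IH]; first by rewrite !expn1.
have E : (a ^ i.+1.*2.+1 + b ^ i.+1.*2.+1 + a * b * (a ^ i.*2.+1 + b ^ i.*2.+1)
          = (a + b) * (a ^ i.*2.+2 + b ^ i.*2.+2))%N.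
  by rewrite doubleS !expnS; ring.
by rewrite -(dvdn_addl _ (dvdn_mull (a * b) IH)) E dvdn_mulr.
Qed.

(** The modulus is first index plus last. Peeling off both end terms keeps it fixed, so the
    induction needs [c] to vary. *)
Lemma sum_expn_even_length (k c i : nat) : odd k ->
  (c + (c + i.*2).-1 %| \sum_(c <= j < c + i.*2) j ^ k)%N.
Proof.
move=> hk; elim: i c => [|i IH] c; first by rewrite addn0 big_geq ?dvdn0.
rewrite doubleS !addnS /= big_nat_recr /=; last by lia.
rewrite big_ltn; last by lia.
rewrite addnAC dvdn_add //; first by rewrite -addnS dvdn_addXX_odd.
case: i IH => [|i] IH; first by rewrite big_geq ?dvdn0 //; lia.
by move: (IH c.+1); rewrite !addSn /= -addnS.
Qed.

(** Same peeling, with [c + i] as the centre of the range: each outer pair of indices adds up to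
    twice the centre. *)
Lemma sum_expn_odd_length (k c i : nat) : odd k ->
  (\sum_(c <= j < (c + i.*2).+1) j ^ k = (c + i) ^ k %[mod (c + i).*2])%N.
Proof.
move=> hk; elim: i c => [|i IH] c; first by rewrite !addn0 big_nat1.
rewrite doubleS !addnS big_nat_recr /=; last by lia.
rewrite big_ltn; last by lia.
have /dvdnP[q Eq] : ((c + i).+1.*2 %| c ^ k + (c + i.*2).+2 ^ k)%N.
  have -> : ((c + i).+1.*2 = c + (c + i.*2).+2)%N by lia.
  exact: dvdn_addXX_odd.
by rewrite addnAC Eq modnMDl; move: (IH c.+1); rewrite !addSn.
Qed.

Lemma dvdn_sum_expn (k n : nat) : (1 < k)%N -> odd k -> (0 < n)%N ->
  (n %| \sum_(1 <= j < n.+1) j ^ k)%N = (n %% 4 != 2)%N.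
Proof.
move=> k1 hk n0.
(* The extra term [0 ^ k] gives [n] a partner and makes the first and last index add up to [n]. *)
have -> : (\sum_(1 <= j < n.+1) j ^ k = \sum_(0 <= j < n.+1) j ^ k)%N.
  by rewrite [RHS]big_ltn // exp0n ?add0n //; lia.
have [on|en] := boolP (odd n).
  have -> : (n %% 4 != 2)%N by lia.
  have E : n.+1 = (0 + (n.+1)./2.*2)%N by lia.
  by have := sum_expn_even_length k 0 (n.+1)./2 hk; rewrite -E.
have En : n = n./2.*2 by lia.
set m := n./2 in En.
have := sum_expn_odd_length k 0 m hk; rewrite !add0n -En => H.
rewrite /dvdn H -/(dvdn _ _) En.
have -> : (m.*2 %% 4 != 2)%N = ~~ odd m by lia.
have m0 : (0 < m)%N by lia.
(* Cancelling [m] leaves [2 %| m ^ k.-1]; as [k.-1] is positive, this is the parity of [m]. *)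
have -> : (m ^ k = m * m ^ k.-1)%N by rewrite -expnS prednK //; lia.
rewrite -muln2 dvdn_pmul2l // dvdn2 oddX.
by have -> : (k.-1 == 0)%N = false by lia.
Qed.

Lemma rat_div_int (a n : nat) : (0 < n)%N ->
  ((n%:R^-1 * a%:R : rat) \is a Num.int) = (n %| a)%N.
Proof.
move=> n0; have nz : n%:R != 0 :> rat by rewrite pnatr_eq0 -lt0n.
apply/idP/idP => [/intrP[z Ez]|/dvdnP[q ->]]; last first.
  by rewrite mulnC natrM mulKf.
have : (a%:Z)%:~R = (n%:Z * z)%:~R :> rat.
  by rewrite intrM -Ez mulVKf.
move/intr_inj => E.
(* Divisibility in [int] is defined on absolute values, so it computes to the goal in [nat]. *)
by have : (n%:Z %| a%:Z)%Z by rewrite E dvdz_mulr.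
Qed.

Theorem theorem1 (k n : nat) (hk3 : (3 <= k)%N) (hkodd : odd k) (hn : (1 <= n)%N) :
  mu k n \is a Num.int <-> (n <> 2 %[mod 4])%N.
Proof.
have -> : mu k n = n%:R^-1 * (\sum_(1 <= j < n.+1) j ^ k)%N%:R.
  by rewrite /mu natr_sum; congr (_ * _); apply: eq_bigr => j _; rewrite natrX.
rewrite rat_div_int // dvdn_sum_expn //; last exact: ltnW.
by split=> /eqP.
Qed.
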